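(* Let $\mu$ be a non-atomic Borel probability measure on $[0,1]$ and let $z\in\mathbb{R}$. Then $$\|c_{\lambda,\mu}(z,\cdot)\|_{L_2(\mu)}^2=\sum_{n=0}^\infty(-1)^n z^{2n}\sum_{k=0}^n(n+1-2k)\,p_{2k}\,p_{2n+1-2k}$$ and $$\|s_{\lambda,\mu}(z,\cdot)\|_{L_2(\mu)}^2=\sum_{n=0}^\infty(-1)^n z^{2n+2}\sum_{k=0}^{n+1}(n+1-2k)\,q_{2k+1}\,q_{2n+2-2k},$$ where $p_j=p_j(1)$ and $q_j=q_j(1)$.
   Context: Functions $p_n,q_n$: for $x\in[0,1]$ put $p_0(x)=q_0(x)=1$ and, for $n\in\mathbb{N}=\{1,2,\dots\}$: for odd $n$, $p_n(x)=\int_0^x p_{n-1}(t)\,d\mu(t)$ and $q_n(x)=\int_0^x q_{n-1}(t)\,dt$; for even $n$, $p_n(x)=\int_0^x p_{n-1}(t)\,dt$ and $q_n(x)=\int_0^x q_{n-1}(t)\,d\mu(t)$. For $z\in\mathbb{R}$, $x\in[0,1]$ (absolutely convergent series; the index $\lambda$ denotes Lebesgue measure): $c_{\lambda,\mu}(z,x)=\sum_{n=0}^\infty(-1)^n z^{2n}p_{2n}(x)$ and $s_{\lambda,\mu}(z,x)=\sum_{n=0}^\infty(-1)^n z^{2n+1}q_{2n+1}(x)$. *)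

(* Defs.v *)
From HB Require Import structures.
From mathcomp Require Import all_boot all_order all_algebra.
From mathcomp Require Import all_classical all_reals all_analysis.

Set Implicit Arguments.
Unset Strict Implicit.
Unset Printing Implicit Defensive.

Import Order.TTheory GRing.Theory Num.Theory.
Import numFieldNormedType.Exports.

Local Open Scope classical_set_scope.
Local Open Scope ring_scope.

(* A Borel probability measure on [0,1] is represented as a probability [mu]
   on the Borel sets of R with mu [0,1] = 1. The functions below are total on R,
   but only their values on [0,1] matter: the complement is mu-null. *)

Definition atom d (T : measurableType d) (R : realType)
    (mu : {measure set T -> \bar R}) (A : set T) : Prop :=
  [/\ measurable A, (0 < mu A)%E &
      forall B : set T, measurable B -> B `<=` A ->
        mu B = 0%E \/ mu B = mu A].

Definition nonatomic d (T : measurableType d) (R : realType)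
    (mu : {measure set T -> \bar R}) : Prop :=
  forall A : set T, ~ atom mu A.

Section trigonometric_functions.
Context {R : realType} (mu : probability (measurableTypeR R) R).

Fixpoint trig_p (n : nat) (x : R) : R :=
  if n is m.+1 then
    if odd n then \int[mu]_(t in `[0, x]) trig_p m t
    else \int[lebesgue_measure]_(t in `[0, x]) trig_p m t
  else 1.

Fixpoint trig_q (n : nat) (x : R) : R :=
  if n is m.+1 then
    if odd n then \int[lebesgue_measure]_(t in `[0, x]) trig_q m t
    else \int[mu]_(t in `[0, x]) trig_q m t
  else 1.

Definition trig_cos (z x : R) : R :=
  limn (series (fun n : nat => (-1) ^+ n * z ^+ (2 * n) * trig_p (2 * n) x)).

Definition trig_sin (z x : R) : R :=
  limn (series (fun n : nat =>
    (-1) ^+ n * z ^+ (2 * n + 1) * trig_q (2 * n + 1) x)).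

Definition trig_p1 (n : nat) : R := trig_p n 1.
Definition trig_q1 (n : nat) : R := trig_q n 1.

End trigonometric_functions.

(* [v] is the sum of the convergent real series with general term [a];
   in particular [v] is finite. *)
Definition is_sum (R : realType) (a : nat -> R) (v : \bar R) : Prop :=
  cvgn (series a) /\ v = (limn (series a))%:E.

(* Main.v *)
Require Import Defs.
From HB Require Import structures.
From mathcomp Require Import all_boot all_order all_algebra.
From mathcomp Require Import ring zify.
From mathcomp Require Import all_classical all_reals all_analysis.
From mathcomp Require Import measurable_realfun.

Set Implicit Arguments.
Unset Strict Implicit.
Unset Printing Implicit Defensive.

Import Order.TTheory GRing.Theory Num.Theory.
Import numFieldNormedType.Exports.

Local Open Scope classical_set_scope.
Local Open Scope ring_scope.

(** Square the series pointwise and integrate term by term: the squared norm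
    of [c] is the sum of the [sum_k a_k a_(n-k)] integrated against [mu].  Put
    [A_k = \int p_(2k) p_(2n-2k) dmu] and [B_k = \int p_(2k-1) p_(2n+1-2k) dt],
    with [B_0 = 0].  Integration by parts gives
    [p_(2k)(1) p_(2n+1-2k)(1) = A_k + B_k].  In the sum with weights
    [n+1-2k], the reflection [k -> n+1-k] changes the sign of the weights and
    fixes [B], so [B] drops out; the reflection [k -> n-k] fixes [A] and turns
    the weight into [2 - (n+1-2k)], so that each [A_k] effectively gets weight
    [1].  The sine is handled in the same way with the two measures exchanged. *)

(** * Cauchy squares of series with an exponential majorant *)

Lemma series_convolution (R : pzRingType) (a : nat -> R) N :
  \sum_(0 <= n < N) \sum_(0 <= k < n.+1) a k * a (n - k)%N =
  \sum_(0 <= i < N) \sum_(0 <= j < N - i) a i * a j.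
Proof.
elim: N => [|N IH]; first by rewrite !big_nil.
rewrite [LHS]big_nat_recr//= [RHS]big_nat_recr//= {}IH subSnn big_nat1.
rewrite [in LHS]big_nat_recr//= subnn addrA -big_split/=; congr (_ + _).
apply: eq_big_nat => i /andP[_ iN].
by rewrite subSn ?(ltnW iN)// big_nat_recr.
Qed.

(** The square runs over all index pairs [i, j < N], the convolution over those with [i + j < N], so
    only a corner remains. In this form the difference for [a] is dominated termwise by the one for
    a majorant. *)
Lemma sqr_series_subconvolution (R : pzRingType) (a : nat -> R) N :
  (\sum_(0 <= i < N) a i) ^+ 2 -
    \sum_(0 <= n < N) \sum_(0 <= k < n.+1) a k * a (n - k)%N =
  \sum_(0 <= i < N) \sum_(N - i <= j < N) a i * a j.
Proof.
rewrite series_convolution expr2 mulr_suml -sumrB; apply: eq_bigr => i _.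
rewrite mulr_sumr (@big_cat_nat _ _ _ (N - i)) ?leq_subr//=.
by rewrite [X in X - _]addrC addrK.
Qed.

(** The binomial theorem divided by [n!]. The Cauchy square of an exponential majorant is thus again
    exponential, with [2 * y]. *)
Lemma exp_coeff_convolution (R : realType) (y : R) n :
  \sum_(0 <= k < n.+1) exp_coeff y k * exp_coeff y (n - k)%N =
  exp_coeff (2 * y) n.
Proof.
rewrite /exp_coeff/= mulr_natl mulr2n exprDn big_mkord mulr_suml.
apply: eq_bigr => -[k/=]; rewrite ltnS => kn _.
rewrite -(bin_fact kn) !natrM -[_ *+ 'C(n, k)]mulr_natr.
have ? : k`!%:R != 0 :> R by rewrite pnatr_eq0 -lt0n fact_gt0.
have ? : (n - k)`!%:R != 0 :> R by rewrite pnatr_eq0 -lt0n fact_gt0.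
have ? : ('C(n, k))%:R != 0 :> R by rewrite pnatr_eq0 -lt0n bin_gt0.
by field; rewrite ?andbT; do ?[apply/andP; split].
Qed.

Section cauchy_square.
Context {R : realType} (a : nat -> R) (C y : R).
Hypothesis a_le : forall n, `|a n| <= C * exp_coeff y n.

Lemma cvg_series_exp_bound : cvgn (series a).
Proof.
apply: normed_cvg; apply: (series_le_cvg _ _ a_le) => // [n|].
  exact: le_trans (a_le n).
exact/(@is_cvg_seriesZ _ (exp_coeff y) C)/is_cvg_series_exp_coeff.
Qed.

Lemma convolution_le n :
  `|\sum_(0 <= k < n.+1) a k * a (n - k)%N| <= C ^+ 2 * exp_coeff (2 * y) n.
Proof.
rewrite -exp_coeff_convolution mulr_sumr; apply: le_trans (ler_norm_sum _ _ _) _.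
apply: ler_sum => k _; rewrite normrM expr2 mulrACA.
exact: ler_pM.
Qed.

(* The difference between the square of a partial sum and the partial sum of
   the convolution is bounded by the same difference for the exponential
   series, which tends to [exp y ^ 2 - exp (2 y) = 0]. *)
Lemma cvg_series_convolution :
  series (fun n => \sum_(0 <= k < n.+1) a k * a (n - k)%N) @ \oo -->
  (limn (series a)) ^+ 2.
Proof.
pose e := exp_coeff y.
pose D (b : nat -> R) N := series b N ^+ 2 -
    series (fun n => \sum_(0 <= k < n.+1) b k * b (n - k)%N) N.
have De0 : D e @ \oo --> (0 : R).
  have -> : D e = (series e) ^+ 2 - series (exp_coeff (2 * y)).
    apply/funext => N; rewrite /D/=.
    rewrite [X in _ - X](_ : _ = series (exp_coeff (2 * y)) N); first by [].
    by apply: eq_bigr => n _; rewrite exp_coeff_convolution.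
  rewrite -[X in _ --> X](subrr (expR (2 * y))).
  apply: cvgB; last exact: is_cvg_series_exp_coeff.
  rewrite mulr_natl mulr2n expRD -expr2.
  have ce := is_cvg_series_exp_coeff (y : R).
  rewrite [X in X @ _](_ : _ = series e * series e)//.
  exact: cvgM.
have Da0 : D a @ \oo --> (0 : R).
  apply/norm_cvg0P.
  apply: (@squeeze_cvgr _ _ _ _ (cst 0) (fun N => C ^+ 2 * D e N)).
  - apply: nearW => N; rewrite normr_ge0/= /D /series/=.
    rewrite !sqr_series_subconvolution mulr_sumr.
    apply: le_trans (ler_norm_sum _ _ _) _; apply: ler_sum => i _.
    rewrite mulr_sumr.
    apply: le_trans (ler_norm_sum _ _ _) _; apply: ler_sum => j _.
    by rewrite normrM expr2 mulrACA; apply: ler_pM.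
  - exact: cvg_cst.
  - by rewrite -[X in _ --> X](mulr0 (C ^+ 2)); apply: cvgZr.
rewrite [X in X @ _](_ : _ = series a * series a - D a); last first.
  by apply/funext => N; rewrite /D /= !fctE expr2 subKr.
rewrite -[X in _ --> X]subr0; apply: cvgB => //.
by apply: cvgM; exact: cvg_series_exp_bound.
Qed.

End cauchy_square.

(** * Cumulative integrals of nonnegative nondecreasing functions *)

(** A class stable under products and cumulative integration. Its members are measurable, and
    bounded on [[0, x]] by their value at [x], hence integrable there. For [x < 0] the interval is
    empty, so cumulative integrals are monotone on the whole line. *)
Definition ge0_nd (R : realType) (f : R -> R) :=
  (forall x, 0 <= f x) /\ {homo f : x y / x <= y}.

Lemma ge0_ndM (R : realType) (f g : R -> R) :
  ge0_nd f -> ge0_nd g -> ge0_nd (f \* g).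
Proof.
move=> [f0 fnd] [g0 gnd]; split=> [x|x y xy]; first exact: mulr_ge0.
by rewrite ler_pM// ?fnd ?gnd.
Qed.

Lemma ge0_nd_measurable (R : realType) (f : R -> R) :
  ge0_nd f -> measurable_fun [set: R] f.
Proof. by move=> [_ fnd]; exact: nondecreasing_measurable. Qed.

Section cumulative_integral.
Context {R : realType}.
Implicit Types (nu : {measure set (measurableTypeR R) -> \bar R}) (f : R -> R).

(** Shared by [mu] and by Lebesgue measure, which is infinite on the line, so that either can take
    either role. *)
Definition finite_on_itv nu := forall x : R, (nu `[0%R, x]%classic < +oo)%E.

Definition cumint nu f (x : R) : R := \int[nu]_(t in `[0, x]) f t.

Lemma ge0_nd_integrable nu f (A : set R) (x : R) : finite_on_itv nu ->
  ge0_nd f -> measurable A -> A `<=` `[0, x] -> nu.-integrable A (EFin \o f).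
Proof.
move=> nufin fnd mA A0x; apply: measurable_bounded_integrable => //.
- apply: le_lt_trans (nufin x); apply: le_measure => //; rewrite inE//.
- apply: measurable_funTS; exact: ge0_nd_measurable.
- exists (f x); split; first exact: num_real.
  move=> M fxM t /= /A0x; rewrite /= in_itv/= => /andP[_ tx].
  case: fnd => f0 fnd; rewrite ger0_norm//.
  exact: le_trans (fnd _ _ tx) (ltW fxM).
Qed.

Lemma ge0_nd_cumintE nu f x : finite_on_itv nu -> ge0_nd f ->
  (\int[nu]_(t in `[0%R, x]) (f t)%:E)%E = (cumint nu f x)%:E.
Proof.
move=> nufin fnd; rewrite fineK//; apply: integrable_fin_num => //.
exact: (ge0_nd_integrable (x := x)).
Qed.

Lemma ge0_nd_cumint nu f : finite_on_itv nu -> ge0_nd f -> ge0_nd (cumint nu f).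
Proof.
move=> nufin fnd; split=> [x|x y xy].
  by apply: Rintegral_ge0 => t _; exact: fnd.1.
rewrite -lee_fin -!ge0_nd_cumintE//; apply: ge0_subset_integral => //.
- by apply/measurable_EFinP/measurable_funTS; exact: ge0_nd_measurable.
- by move=> t _; rewrite lee_fin; exact: fnd.1.
- by apply: subset_itvl; rewrite bnd_simp.
Qed.

Lemma cumint_le_sup nu f x : finite_on_itv nu -> ge0_nd f ->
  cumint nu f x <= f x * fine (nu `[0, x]%classic).
Proof.
move=> nufin fnd; rewrite -[leRHS](Rintegral_cst nu)//.
apply: le_Rintegral => //; first exact: (ge0_nd_integrable (x := x)).
  apply: (@ge0_nd_integrable nu (cst (f x)) _ x) => //.
  by split=> [?|//]; exact: fnd.1.
by move=> t; rewrite /= in_itv/= => /andP[_ tx]; exact: fnd.2.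
Qed.

End cumulative_integral.

(** * Iterated Lebesgue integrals and the bounds [x ^ n / n!] *)

Section exp_bound.
Context {R : realType}.
Implicit Types (nu : {measure set (measurableTypeR R) -> \bar R}) (f g : R -> R).
Local Notation leb := (@lebesgue_measure R).

Lemma lebesgue_itv0 (x : R) : leb `[0, x]%classic = (Num.max x 0)%:E.
Proof.
rewrite lebesgue_measure_itv/= lte_fin; case: ltrP => [x0|x0].
  by rewrite oppr0 adde0.
by [].
Qed.

Lemma lebesgue_finite_on_itv : finite_on_itv leb.
Proof. by move=> x; rewrite [X in (X < _)%E](lebesgue_itv0 x) ltry. Qed.

Lemma le_cumint nu f g : finite_on_itv nu -> ge0_nd f -> ge0_nd g ->
  (forall x, f x <= g x) -> forall x, cumint nu f x <= cumint nu g x.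
Proof.
move=> nufin fnd gnd fg x.
by apply: le_Rintegral => //; exact: (ge0_nd_integrable (x := x)).
Qed.

(** This is [x ^ n / n!] for [x >= 0], continued to the left by its value at [0] so that it is
    monotone on the whole line. *)
Definition posXn_fact (n : nat) (x : R) : R := exp_coeff (Num.max x 0) n.

Lemma ge0_nd_posXn_fact n : ge0_nd (posXn_fact n).
Proof.
split=> [x|x y xy]; first by rewrite exp_coeff_ge0// le_max lexx orbT.
rewrite /posXn_fact/exp_coeff/= ler_pM2r ?invr_gt0 ?ltr0n ?fact_gt0//.
by apply: lerXn2r; rewrite ?nnegrE ?ge_max !le_max ?xy ?lexx ?orbT.
Qed.

Lemma cumint_posXn_fact n x :
  cumint leb (posXn_fact n) x = posXn_fact n.+1 x.
Proof.
(* For [x <= 0] the interval has Lebesgue measure [0], and the right side is [0] because its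
   exponent [n.+1] is positive. *)
have [x0|x0] := leP x 0.
  rewrite /posXn_fact/exp_coeff/= max_r// expr0n/= mul0r; apply/eqP.
  have nd := ge0_nd_posXn_fact n.
  rewrite eq_le (ge0_nd_cumint lebesgue_finite_on_itv nd).1 andbT.
  have := cumint_le_sup x lebesgue_finite_on_itv nd.
  by rewrite [X in fine X](lebesgue_itv0 x) max_r//= mulr0.
transitivity (\int[leb]_(t in `[0, x]) (n`!%:R^-1 * t ^+ n)).
  apply: eq_Rintegral => t; rewrite inE/= in_itv/= => /andP[t0 _].
  by rewrite /posXn_fact/exp_coeff/= max_l// mulrC.
pose F (t : R) := t ^+ n.+1 / n.+1`!%:R.
have dF (t : R) : is_derive t 1 F (n`!%:R^-1 * t ^+ n).
  have -> : F = n.+1`!%:R^-1 *: (@id R ^+ n.+1).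
    by apply/funext => u; rewrite /F/= !fctE mulrC.
  apply: is_derive_eq.
  rewrite -[LHS]/(n.+1`!%:R^-1 * (n.+1%:R * t ^+ n * 1)) mulr1 factS natrM.
  by rewrite invfM -mulrA mulrCA mulKf// pnatr_eq0.
have cF : continuous F.
  by move=> t; apply/differentiable_continuous/derivable1_diffP/ex_derive.
rewrite /Rintegral (@continuous_FTC2 _ _ F)//=.
- by rewrite /F /posXn_fact/exp_coeff/= max_l ?ltW// expr0n/= mul0r subr0.
- apply: continuous_subspaceT => t.
  by apply: cvgZr; exact: exprn_continuous.
- split=> [t _||].
  + exact: ex_derive.
  + exact/cvg_at_right_filter/cF.
  + exact/cvg_at_left_filter/cF.
- by move=> t _; rewrite derive1E derive_val.
Qed.

End exp_bound.

(** * Integration by parts from Tonelli's theorem *)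

Section integration_by_parts.
Context {R : realType}.
Variable mu : {sigma_finite_measure set (measurableTypeR R) -> \bar R}.
Variables f g : R -> R.
Hypotheses (mufin : finite_on_itv mu) (fnd : ge0_nd f) (gnd : ge0_nd g).
Local Notation leb := (@lebesgue_measure R).

(** The integrand for Tonelli on the triangle [0 <= s <= t <= 1]: [t = z.1] is integrated against
    Lebesgue measure, [s = z.2] against [mu]. *)
Let h (z : measurableTypeR R * measurableTypeR R) : R :=
  f z.1 * g z.2 * [&& 0 <= z.2, z.2 <= z.1 & z.1 <= 1]%:R.

Let mh : measurable_fun setT (EFin \o h).
Proof.
apply/measurable_EFinP; rewrite /h; apply: measurable_funM.
  apply: measurable_funM.
    by apply: (measurableT_comp (ge0_nd_measurable fnd)).
  by apply: (measurableT_comp (ge0_nd_measurable gnd)).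
pose b (z : measurableTypeR R * measurableTypeR R) :=
  [&& 0 <= z.2, z.2 <= z.1 & z.1 <= 1].
have mb : measurable_fun setT b.
  by apply: measurable_and; [|apply: measurable_and];
    apply: measurable_fun_ler.
rewrite (_ : (fun _ => _) = (fun b : bool => b%:R : R) \o b)//.
exact: measurableT_comp.
Qed.

Let h_ge0 z : (0 <= (h z)%:E)%E.
Proof. by rewrite lee_fin !mulr_ge0 ?fnd.1 ?gnd.1. Qed.

Let h_section1 (t : R) : (\int[mu]_s (h (t, s))%:E)%E =
  ((fun t => (f t * cumint mu g t)%:E) \_ `[0%R, 1%R]) t.
Proof.
rewrite patchE; case: ifPn => [|] t01.
- transitivity (\int[mu]_(s in `[0%R, t]) ((f t)%:E * (g s)%:E))%E.
    rewrite [RHS]integral_mkcond; apply: eq_integral => s _.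
    rewrite patchE mem_setE in_itv/= /h/=.
    move: t01; rewrite inE/= in_itv/= => /andP[_ ->]; rewrite andbT.
    by case: ifPn => _; rewrite ?mulr1// mulr0.
  rewrite ge0_integralZl ?lee_fin ?fnd.1//.
  + by rewrite ge0_nd_cumintE.
  + by apply/measurable_EFinP/measurable_funTS; exact: ge0_nd_measurable.
  + by move=> s _; rewrite lee_fin gnd.1.
- rewrite integral0_eq// => s _; rewrite /h/=.
  case: and3P => [[s0 st t1]|_]; last by rewrite mulr0.
  by move: t01; rewrite notin_setE/= in_itv/= t1 (le_trans s0 st).
Qed.

Let h_section2 (s : R) : (\int[leb]_t (h (t, s))%:E)%E =
  ((fun s => (g s * (cumint leb f 1 - cumint leb f s))%:E) \_ `[0%R, 1%R]) s.
Proof.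
have ifl (A : set R) : measurable A -> A `<=` `[0, 1] ->
    leb.-integrable A (EFin \o f).
  by apply: ge0_nd_integrable => //; exact: lebesgue_finite_on_itv.
rewrite patchE; case: ifPn => [|] s01.
- have [s0 s1] : 0 <= s /\ s <= 1.
    by move: s01; rewrite inE/= in_itv/= => /andP[].
  transitivity (\int[leb]_(t in `[s, 1%R]) ((g s)%:E * (f t)%:E))%E.
    rewrite [RHS]integral_mkcond; apply: eq_integral => t _.
    rewrite patchE mem_setE in_itv/= /h/= s0/=.
    by case: ifPn => _; rewrite ?mulr1 1?mulrC// mul0r.
  rewrite ge0_integralZl ?lee_fin ?gnd.1//; last 2 first.
  + by apply/measurable_EFinP/measurable_funTS; exact: ge0_nd_measurable.
  + by move=> t _; rewrite lee_fin fnd.1.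
  rewrite /cumint Rintegral_itvB ?bnd_simp//; last exact: ifl.
  (* The difference of cumulative integrals omits the endpoint [s], which the section of the closed
     triangle contains; this point is Lebesgue-null. *)
  rewrite Rintegral_itv_obnd_cbnd; last first.
    by apply: ifl => //; apply: subset_itv; rewrite bnd_simp.
  rewrite /Rintegral EFinM fineK//; apply: integrable_fin_num => //.
  by apply: ifl => //; apply: subset_itvr; rewrite bnd_simp.
- rewrite integral0_eq// => t _; rewrite /h/=.
  case: and3P => [[s0 st t1]|_]; last by rewrite mulr0.
  by move: s01; rewrite notin_setE/= in_itv/= s0 (le_trans st t1).
Qed.

(** With [F] and [G] the cumulative integrals of [f] (Lebesgue) and [g] ([mu]), Tonelli for [h] says
    that the Lebesgue integral of [f G] is the [mu]-integral of [g (F(1) - F)]. All terms are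
    finite, so the latter splits into [F(1) G(1)] minus the integral of [g F]. *)
Lemma cumint_by_parts : cumint mu g 1 * cumint leb f 1 =
  cumint mu (g \* cumint leb f) 1 + cumint leb (f \* cumint mu g) 1.
Proof.
have lfin := @lebesgue_finite_on_itv R.
have Fnd := ge0_nd_cumint lfin fnd.
have Gnd := ge0_nd_cumint mufin gnd.
have := @fubini_tonelli _ _ _ _ _ leb mu (EFin \o h) mh h_ge0.
under eq_integral do rewrite h_section1.
under [in RHS]eq_integral do rewrite h_section2.
rewrite -!integral_mkcond => /(congr1 fine) E.
have {}E : cumint leb (f \* cumint mu g) 1 =
    \int[mu]_(s in `[0, 1]) (cumint leb f 1 * g s - (g \* cumint leb f) s).
  by rewrite /cumint /Rintegral E; congr fine; apply: eq_integral => s _;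
    rewrite /= mulrBr mulrC.
have ig := ge0_nd_integrable mufin gnd (measurable_itv _) (@subset_refl _ `[0,1]).
rewrite E RintegralB//; last 2 first.
- rewrite (_ : EFin \o _ =
    fun s => ((cumint leb f 1)%:E * (EFin \o g) s)%E); last by [].
  exact: integrableZl.
- exact: ge0_nd_integrable mufin (ge0_ndM gnd Fnd) _ (@subset_refl _ _).
by rewrite RintegralZl// addrC subrK mulrC.
Qed.

End integration_by_parts.

(** * Weighted sums under the two reflections *)

Lemma sum_symmetric_weights (R : realFieldType) (A B : nat -> R) n :
  A n.+1 = 0 ->
  (forall k, (k <= n)%N -> A (n - k)%N = A k) ->
  (forall k, (k <= n.+1)%N -> B (n.+1 - k)%N = B k) ->
  \sum_(0 <= k < n.+2) (n%:R + 1 - 2 * k%:R) * (A k + B k) =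
  \sum_(0 <= k < n.+1) A k.
Proof.
move=> An1 symA symB; pose w k : R := n%:R + 1 - 2 * k%:R.
under eq_bigr do rewrite mulrDr; rewrite big_split/=.
have -> : \sum_(0 <= k < n.+2) w k * B k = 0.
  (* Twice the sum is the sum plus its reversal [k -> n.+1 - k], whose weights are opposite. *)
  apply: (@mulIf _ 2); first by rewrite pnatr_eq0.
  rewrite mul0r mulr_natr mulr2n {1}big_nat_rev/= -big_split/=.
  rewrite big_nat_cond big1// => k /andP[/andP[_ kn] _].
  by rewrite add0n subSS symB// /w natrB//; ring.
(* As [A n.+1 = 0], the range shrinks to [k <= n], which [k -> n - k] preserves; the weights at [k]
   and [n - k] add up to [2]. *)
rewrite addr0 big_nat_recr//= An1 mulr0 addr0.
apply: (@mulIf _ 2); first by rewrite pnatr_eq0.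
rewrite mulr_natr [LHS]mulr2n {1}big_nat_rev/= -big_split/= mulr_suml.
apply: eq_big_nat => k /andP[_ kn].
by rewrite add0n subSS symA// natrB//; ring.
Qed.

(** * Iterated integrals against two alternating measures *)

Section alternating.
Context {R : realType}.
Implicit Types m : {measure set (measurableTypeR R) -> \bar R}.

(** [m1] acts at odd stages, [m2] at even ones: the pair [mu], Lebesgue gives [p_n], the reversed
    pair [q_n]. *)
Fixpoint alternating m1 m2 (n : nat) : R -> R :=
  if n is k.+1 then cumint (if odd k then m2 else m1) (alternating m1 m2 k)
  else fun=> 1.

Section pair.
Variables m1 m2 : {measure set (measurableTypeR R) -> \bar R}.
Hypotheses (fin1 : finite_on_itv m1) (fin2 : finite_on_itv m2).
Local Notation u := (alternating m1 m2).

Lemma alternating_odd k : u (2 * k).+1 = cumint m1 (u (2 * k)%N).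
Proof. by rewrite /= oddM. Qed.

Lemma alternating_even k : u (2 * k.+1)%N = cumint m2 (u (2 * k).+1).
Proof. by rewrite mulnS/= oddM. Qed.

Lemma ge0_nd_alternating n : ge0_nd (u n).
Proof.
elim: n => [|n IH]/=; first by split.
by apply: ge0_nd_cumint => //; case: ifP.
Qed.

(** Only the Lebesgue half of a double step raises the order of the bound. It comes second for [p]
    and first for [q], so the double step is kept as a hypothesis. *)
Lemma alternating_even_le k :
  (forall f n, ge0_nd f -> (forall x, f x <= posXn_fact n x) ->
    forall x, cumint m2 (cumint m1 f) x <= posXn_fact n.+1 x) ->
  forall x, u (2 * k)%N x <= posXn_fact k x.
Proof.
move=> H; elim: k => [|k IH] x.
  by rewrite muln0 /posXn_fact/exp_coeff/= expr0 divr1.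
rewrite alternating_even alternating_odd; apply: H => //.
exact: ge0_nd_alternating.
Qed.

Hypothesis by_parts : forall f g, ge0_nd f -> ge0_nd g ->
  cumint m1 f 1 * cumint m2 g 1 =
  cumint m1 (f \* cumint m2 g) 1 + cumint m2 (g \* cumint m1 f) 1.

Let cumintC m f g : cumint m (f \* g) 1 = cumint m (g \* f) 1.
Proof. by congr cumint; apply/funext => x /=; rewrite mulrC. Qed.

Lemma sum_alternating_even n :
  \sum_(0 <= k < n.+1)
    (n%:R + 1 - 2 * k%:R) * (u (2 * k)%N 1 * u (2 * (n - k)).+1 1) =
  \sum_(0 <= k < n.+1) cumint m1 (u (2 * k)%N \* u (2 * (n - k))%N) 1.
Proof.
pose A k := if (k <= n)%N then
  cumint m1 (u (2 * k)%N \* u (2 * (n - k))%N) 1 else 0.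
(* [B] is [0] at [k = 0], where [u 0 = 1] is not an integral, and hence also at [k = n.+1], to
   respect the reflection. *)
pose B k := if (0 < k <= n)%N then
  cumint m2 (u (2 * k.-1).+1 \* u (2 * (n - k)).+1) 1 else 0.
transitivity (\sum_(0 <= k < n.+1) A k); last first.
  by apply: eq_big_nat => k /andP[_ kn]; rewrite /A -ltnS kn.
rewrite -(@sum_symmetric_weights _ A B); last 3 first.
- by rewrite /A ltnn.
- by move=> k kn; rewrite /A kn leq_subr subKn// cumintC.
- move=> k kn; rewrite /B.
  have -> : (0 < n.+1 - k <= n)%N = (0 < k <= n)%N by lia.
  case: ifP => // k0n; rewrite cumintC.
  have -> : (n - (n.+1 - k) = k.-1)%N by lia.
  by have -> : ((n.+1 - k).-1 = n - k)%N by lia.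
rewrite [RHS]big_nat_recr//= /A /B !ltnn andbF addr0 mulr0 addr0.
(* At [k = 0] the factor [u 0 1] is [1] and the product is [A 0] alone; the other indices use
   integration by parts. *)
apply: eq_big_nat => -[|k] /andP[_]; rewrite ltnS => kn; congr (_ * _).
  rewrite /= addr0 mul1r subn0 -/(alternating _ _ _) oddM/=.
  by congr cumint; apply/funext => x /=; rewrite mul1r.
rewrite kn andbT ltn0Sn -[k.+1.-1]/k.
have := by_parts (ge0_nd_alternating (2 * (n - k.+1)))
  (ge0_nd_alternating (2 * k).+1).
rewrite -alternating_odd -alternating_even => E.
by rewrite mulrC E cumintC.
Qed.

Lemma sum_alternating_odd n :
  \sum_(0 <= k < n.+2)
    (n%:R + 1 - 2 * k%:R) * (u (2 * k).+1 1 * u (2 * (n.+1 - k))%N 1) =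
  \sum_(0 <= k < n.+1) cumint m2 (u (2 * k).+1 \* u (2 * (n - k)).+1) 1.
Proof.
pose A k := if (k <= n)%N then
  cumint m2 (u (2 * k).+1 \* u (2 * (n - k)).+1) 1 else 0.
pose B k := cumint m1 (u (2 * k)%N \* u (2 * (n.+1 - k))%N) 1.
transitivity (\sum_(0 <= k < n.+1) A k); last first.
  by apply: eq_big_nat => k /andP[_ kn]; rewrite /A -ltnS kn.
rewrite -(@sum_symmetric_weights _ A B); last 3 first.
- by rewrite /A ltnn.
- by move=> k kn; rewrite /A kn leq_subr subKn// cumintC.
- by move=> k kn; rewrite /B subKn// cumintC.
(* At [k = n.+1] the factor [u 0 1] is [1] and the product is [B n.+1] alone, in agreement with
   [A n.+1 = 0]. *)
apply: eq_big_nat => k /andP[_]; rewrite ltnS leq_eqVlt => /predU1P[->|kn].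
  rewrite /A /B ltnn add0r subnn muln0 mulr1; congr (_ * _).
  rewrite alternating_odd; congr cumint.
  by apply/funext => x /=; rewrite mulr1.
rewrite /A /B -ltnS kn; congr (_ * _).
have := by_parts (ge0_nd_alternating (2 * k))
  (ge0_nd_alternating (2 * (n - k)).+1).
rewrite -alternating_odd -alternating_even -subSn// => ->.
by rewrite addrC cumintC.
Qed.

End pair.
End alternating.

(** * The squared norm of a series of functions *)

Lemma sqr_Lnorm2 d (T : measurableType d) (R : realType)
    (mu : {measure set T -> \bar R}) (c : T -> R) :
  ('N[mu]_2%:E[EFin \o c] ^+ 2 = \int[mu]_x (c x ^+ 2)%:E)%E.
Proof.
have := Lnorm_ge0 mu 2%:E (EFin \o c).
have : ('N[mu]_2%:E[EFin \o c] `^ 2 = \int[mu]_x (c x ^+ 2)%:E)%E.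
  rewrite poweR_Lnorm//; apply: eq_integral => x _.
  by rewrite /= powR_mulrn ?normr_ge0// real_normK// num_real.
case: ('N[mu]_2%:E[EFin \o c])%E => [r| |//] <- r0.
- by rewrite poweR_EFin powR_mulrn// EFin_expe.
- by rewrite poweRyr// expe2 mulyy.
Qed.

(** Bridges the norm, an integral over the whole line, and the coefficients, integrals over
    [[0, 1]]. *)
Lemma integral_full_measure d (T : measurableType d) (R : realType)
    (mu : probability T R) (A : set T) (f : T -> \bar R) :
  measurable A -> mu A = 1%E -> measurable_fun setT f ->
  (forall x, 0 <= f x)%E -> (\int[mu]_x f x = \int[mu]_(x in A) f x)%E.
Proof.
move=> mA muA mf f0.
rewrite (@ge0_negligible_integral _ _ _ _ setT (~` A))// ?setTD ?setCK//.
- exact: measurableC.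
- by have := probability_setC mu mA; rewrite [X in (_ - X)%E]muA subee.
Qed.

Lemma is_sum_EFin (R : realType) (a : nat -> R) (v : \bar R) (w : R) :
  v = w%:E -> series a @ \oo --> w -> is_sum a v.
Proof.
by move=> -> aw; split; [exact: cvgP aw | rewrite (cvg_lim _ aw)].
Qed.

Section Lnorm_of_series.
Context {R : realType} (mu : probability (measurableTypeR R) R).
Hypothesis mu01 : mu `[0, 1]%classic = 1%E.
Variable a : nat -> R -> R.
Hypothesis ma : forall n, measurable_fun [set: R] (a n).
Hypothesis a_le : forall M, exists C y, 0 <= y /\
  forall x, x <= M -> forall n, `|a n x| <= C * exp_coeff y n.

Let integrable_aM i j : mu.-integrable `[0, 1] (EFin \o (a i \* a j)).
Proof.
apply: measurable_bounded_integrable => //.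
- by rewrite [X in (X < _)%E]mu01 ltry.
- by apply: measurable_funTS; exact: (measurable_funM (ma i) (ma j)).
- have [C [y [_ aC]]] := a_le 1.
  exists (C * exp_coeff y i * (C * exp_coeff y j)); split.
    exact: num_real.
  move=> M /ltW CM t /=; rewrite in_itv/= => /andP[_ t1].
  by apply: le_trans CM; rewrite normrM ler_pM// aC.
Qed.

(** Dominated convergence is applied to the partial sums of the Cauchy square, which are finite sums
    of integrable products and so integrate term by term. *)
Lemma is_sum_sqr_Lnorm2_series :
  is_sum (fun n => \sum_(0 <= k < n.+1)
                     \int[mu]_(x in `[0, 1]) (a k \* a (n - k)%N) x)
    ('N[mu]_2%:E[EFin \o (fun x => limn (series (a ^~ x)))] ^+ 2)%E.
Proof.
pose c x := limn (series (a ^~ x)).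
pose D N x := series (fun n => \sum_(0 <= k < n.+1) a k x * a (n - k)%N x) N.
have mc : measurable_fun [set: R] c.
  apply: (@measurable_fun_cvg _ _ _ _ (fun N x => series (a ^~ x) N)).
    by move=> N; exact: measurable_sum.
  (* Taking [M = x] gives convergence at every real [x], hence measurability of the limit on the
     whole line. *)
  move=> x _; have [C [y [_ aC]]] := a_le x.
  exact: cvg_series_exp_bound (aC x (lexx x)).
have mc2 : measurable_fun [set: R] (fun x => (c x ^+ 2)%:E).
  by apply/measurable_EFinP; exact: measurable_funX.
have mD N : measurable_fun [set: R] (EFin \o D N).
  apply/measurable_EFinP; apply: measurable_sum => n; apply: measurable_sum => k.
  exact: (measurable_funM (ma k) (ma (n - k)%N)).
have [C [y [y0 aC]]] := a_le 1.
(* The dominating constant is the sum over [n] of the bounds in [convolution_le]; it is integrable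
   because [mu] is finite. *)
have [] := @dominated_convergence _ _ _ mu `[0%R, 1%R] (measurable_itv _)
  (fun N => EFin \o D N) (fun x => (c x ^+ 2)%:E)
  (cst (C ^+ 2 * expR (2 * y))%:E).
- by move=> N; exact: (measurable_funTS (mD N)).
- exact: (measurable_funTS mc2).
- apply: aeW => x; rewrite /= in_itv/= => /andP[_ x1].
  apply: cvg_EFin; first exact: nearW.
  exact: cvg_series_convolution (aC x x1).
- by apply: finite_measure_integrable_cst; exact: measurable_itv.
- apply: aeW => x N; rewrite /= in_itv/= => /andP[_ x1]; rewrite lee_fin.
  apply: (@le_trans _ _ (C ^+ 2 * series (exp_coeff (2 * y)) N)).
    rewrite mulr_sumr; apply: le_trans (ler_norm_sum _ _ _) _.
    by apply: ler_sum => n _; exact: convolution_le (aC x x1) n.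
  rewrite ler_wpM2l ?sqr_ge0//.
  apply: nondecreasing_cvgn_le; last exact: is_cvg_series_exp_coeff.
  apply/nondecreasing_seqP => n; rewrite seriesSr lerDl exp_coeff_ge0//.
  by rewrite mulr_ge0.
move=> ic2 _; rewrite -[X in _ --> X]fineK; last exact: integrable_fin_num.
move=> /fine_cvg Dc2.
apply: is_sum_EFin.
  rewrite sqr_Lnorm2 (integral_full_measure _ mu01)//.
    by rewrite -[LHS]fineK//; exact: integrable_fin_num.
  by move=> x; rewrite lee_fin sqr_ge0.
apply: cvg_trans Dc2; apply: near_eq_cvg; apply: nearW => N /=.
rewrite /D /series/=.
apply: (congr1 fine (y := (_ : R)%:E)).
transitivity (\int[mu]_(x in `[0%R, 1%R])
    (\sum_(0 <= n < N) \sum_(0 <= k < n.+1) ((a k \* a (n - k)%N) x)%:E))%E.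
  apply: eq_integral => x _; rewrite -sumEFin; apply: eq_bigr => n _.
  by rewrite -sumEFin.
rewrite integral_sum//; last first.
  by move=> n; apply: integrable_sum => // k _; exact: integrable_aM.
rewrite -sumEFin; apply: eq_bigr => n _.
rewrite integral_sum// => [|k]; last exact: integrable_aM.
rewrite -sumEFin; apply: eq_bigr => k _; rewrite fineK//.
by apply: integrable_fin_num => //; exact: integrable_aM.
Qed.

End Lnorm_of_series.

(** * Bounds and coefficient identities for [p_n] and [q_n] *)

Section trigonometric_coefficients.
Context {R : realType} (mu : probability (measurableTypeR R) R).
Local Notation leb := (@lebesgue_measure R).

Lemma trig_pE n : trig_p mu n = alternating mu leb n.
Proof.
elim: n => [//|n IH]; apply/funext => x /=; rewrite -IH.
by case: (odd n).
Qed.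

Lemma trig_qE n : trig_q mu n = alternating leb mu n.
Proof.
elim: n => [//|n IH]; apply/funext => x /=; rewrite -IH.
by case: (odd n).
Qed.

Lemma probability_finite_on_itv : finite_on_itv mu.
Proof.
by move=> x; apply: le_lt_trans (ltry 1); exact: probability_le1.
Qed.

Let mufin := probability_finite_on_itv.
Let lfin := @lebesgue_finite_on_itv R.

(** [[0, x]] has mass at most [1], so integrating against [mu] preserves upper bounds. *)
Lemma cumint_probability_le f x : ge0_nd f -> cumint mu f x <= f x.
Proof.
move=> fnd; apply: le_trans (cumint_le_sup x mufin fnd) _.
rewrite ler_piMr ?fnd.1// -lee_fin fineK ?probability_le1//.
by rewrite ge0_fin_numE.
Qed.

Lemma ge0_nd_trig_p n : ge0_nd (trig_p mu n).
Proof. by rewrite trig_pE; exact: ge0_nd_alternating. Qed.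

Lemma ge0_nd_trig_q n : ge0_nd (trig_q mu n).
Proof. by rewrite trig_qE; exact: ge0_nd_alternating. Qed.

Lemma trig_p_even_le n x : trig_p mu (2 * n) x <= posXn_fact n x.
Proof.
rewrite trig_pE; apply: alternating_even_le => // f k fnd fle y.
rewrite -cumint_posXn_fact; apply: le_cumint => //.
- exact: ge0_nd_cumint.
- exact: ge0_nd_posXn_fact.
- by move=> t; exact: le_trans (cumint_probability_le t fnd) (fle t).
Qed.

Lemma trig_q_even_le n x : trig_q mu (2 * n) x <= posXn_fact n x.
Proof.
rewrite trig_qE; apply: alternating_even_le => // f k fnd fle y.
apply: le_trans (cumint_probability_le y (ge0_nd_cumint lfin fnd)) _.
rewrite -cumint_posXn_fact; apply: le_cumint => //.
exact: ge0_nd_posXn_fact.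
Qed.

(** The last integrand is simply estimated by its value at [x]; the resulting factor [Num.max x 0]
    can be absorbed into the constant of the exponential majorant. *)
Lemma trig_q_odd_le n x :
  trig_q mu (2 * n).+1 x <= posXn_fact n x * Num.max x 0.
Proof.
rewrite trig_qE alternating_odd -trig_qE.
apply: le_trans (cumint_le_sup x lfin (ge0_nd_trig_q _)) _.
rewrite [X in fine X](lebesgue_itv0 x) ler_wpM2r ?le_max ?lexx ?orbT//.
exact: trig_q_even_le.
Qed.

Lemma sum_trig_p n :
  \sum_(0 <= k < n.+1)
    (n%:R + 1 - 2 * k%:R) * (trig_p1 mu (2 * k) * trig_p1 mu (2 * (n - k)).+1) =
  \sum_(0 <= k < n.+1)
    \int[mu]_(x in `[0, 1]) (trig_p mu (2 * k) \* trig_p mu (2 * (n - k))) x.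
Proof.
have by_parts f g : ge0_nd f -> ge0_nd g -> cumint mu f 1 * cumint leb g 1 =
    cumint mu (f \* cumint leb g) 1 + cumint leb (g \* cumint mu f) 1.
  by move=> fnd gnd; exact: cumint_by_parts.
under eq_bigr do rewrite /trig_p1 !trig_pE.
under [RHS]eq_bigr do rewrite !trig_pE.
exact: sum_alternating_even.
Qed.

Lemma sum_trig_q n :
  \sum_(0 <= k < n.+2)
    (n%:R + 1 - 2 * k%:R) * (trig_q1 mu (2 * k).+1 * trig_q1 mu (2 * (n.+1 - k))) =
  \sum_(0 <= k < n.+1)
    \int[mu]_(x in `[0, 1]) (trig_q mu (2 * k).+1 \* trig_q mu (2 * (n - k)).+1) x.
Proof.
have by_parts f g : ge0_nd f -> ge0_nd g -> cumint leb f 1 * cumint mu g 1 =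
    cumint leb (f \* cumint mu g) 1 + cumint mu (g \* cumint leb f) 1.
  (* The same integration by parts, with factors and summands exchanged. *)
  by move=> fnd gnd; rewrite mulrC addrC; exact: cumint_by_parts.
under eq_bigr do rewrite /trig_q1 !trig_qE.
under [RHS]eq_bigr do rewrite !trig_qE.
exact: sum_alternating_odd.
Qed.

End trigonometric_coefficients.

(** * The two norm formulas *)

Lemma exprM_posXn_fact (R : realType) (y x M : R) n : 0 <= y -> x <= M ->
  y ^+ n * posXn_fact n x <= exp_coeff (y * Num.max M 0) n.
Proof.
move=> y0 xM; rewrite /exp_coeff/= exprMn -mulrA.
by rewrite ler_wpM2l ?exprn_ge0//; exact: (ge0_nd_posXn_fact n).2.
Qed.

Lemma Rintegral_scaled_product (R : realType)
    (mu : probability (measurableTypeR R) R) (f g : R -> R) (c d : R) :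
  ge0_nd f -> ge0_nd g ->
  \int[mu]_(x in `[0, 1]) ((c \*o f) \* (d \*o g)) x =
  c * d * \int[mu]_(x in `[0, 1]) (f \* g) x.
Proof.
move=> fnd gnd; rewrite -RintegralZl//; last first.
  apply: (@ge0_nd_integrable _ _ _ _ 1 (probability_finite_on_itv mu)) => //.
  exact: ge0_ndM.
by apply: eq_Rintegral => x _ /=; ring.
Qed.

Theorem proposition4p2 (R : realType) (mu : probability (measurableTypeR R) R)
    (mu01 : mu `[0, 1]%classic = 1%E) (mu_nonatomic : nonatomic mu) (z : R) :
  is_sum
    (fun n : nat => (-1) ^+ n * z ^+ (2 * n) *
       \sum_(0 <= k < n.+1)
         ((n%:R + 1 - 2 * k%:R) * trig_p1 mu (2 * k) * trig_p1 mu (2 * n + 1 - 2 * k)))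
    ('N[mu]_(2%:E)[EFin \o trig_cos mu z] ^+ 2)%E /\
  is_sum
    (fun n : nat => (-1) ^+ n * z ^+ (2 * n + 2) *
       \sum_(0 <= k < n.+2)
         ((n%:R + 1 - 2 * k%:R) * trig_q1 mu (2 * k + 1) * trig_q1 mu (2 * n + 2 - 2 * k)))
    ('N[mu]_(2%:E)[EFin \o trig_sin mu z] ^+ 2)%E.
Proof.
have z20 : 0 <= z ^+ 2 by exact: sqr_ge0.
split.
- pose a n := (-1) ^+ n * z ^+ (2 * n) \*o trig_p mu (2 * n).
  have ma n : measurable_fun [set: R] (a n).
    by apply: measurable_funM => //; exact: ge0_nd_measurable (ge0_nd_trig_p _ _).
  have a_le M : exists C y, 0 <= y /\
      forall x, x <= M -> forall n, `|a n x| <= C * exp_coeff y n.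
    (* [z ^ (2 n) p_(2n)(x)] is at most [(z ^ 2 max(x, 0)) ^ n / n!], an exponential coefficient. *)
    exists 1, (z ^+ 2 * Num.max M 0); split.
      by rewrite mulr_ge0// le_max lexx orbT.
    move=> x xM n; rewrite mul1r; apply: le_trans (exprM_posXn_fact n z20 xM).
    rewrite /a/= !normrM normrX normrN1 expr1n mul1r exprM.
    rewrite (ger0_norm (exprn_ge0 _ z20)) (ger0_norm ((ge0_nd_trig_p _ _).1 _)).
    by apply: ler_wpM2l; [exact: exprn_ge0 | exact: trig_p_even_le].
  have := is_sum_sqr_Lnorm2_series mu01 ma a_le.
  rewrite [X in is_sum X](_ : _ = (fun n : nat => (-1) ^+ n * z ^+ (2 * n) *
       \sum_(0 <= k < n.+1)
         ((n%:R + 1 - 2 * k%:R) * trig_p1 mu (2 * k) *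
          trig_p1 mu (2 * n + 1 - 2 * k))))//.
  apply/funext => n; transitivity ((-1) ^+ n * z ^+ (2 * n) *
      \sum_(0 <= k < n.+1) \int[mu]_(x in `[0, 1])
        (trig_p mu (2 * k) \* trig_p mu (2 * (n - k))) x).
    (* The signs and powers at [k] and [n - k] multiply to the same value for every [k]. *)
    rewrite mulr_sumr; apply: eq_big_nat => k /andP[_]; rewrite ltnS => kn.
    rewrite Rintegral_scaled_product; try exact: ge0_nd_trig_p.
    by rewrite mulrACA -!exprD -mulnDr subnKC.
  rewrite -sum_trig_p; congr (_ * _); apply: eq_big_nat => k /andP[_].
  rewrite ltnS => kn; rewrite mulrA.
  by have -> : (2 * n + 1 - 2 * k = (2 * (n - k)).+1)%N by lia.
- pose a n := (-1) ^+ n * z ^+ (2 * n + 1) \*o trig_q mu (2 * n + 1).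
  have ma n : measurable_fun [set: R] (a n).
    by apply: measurable_funM => //; exact: ge0_nd_measurable (ge0_nd_trig_q _ _).
  have a_le M : exists C y, 0 <= y /\
      forall x, x <= M -> forall n, `|a n x| <= C * exp_coeff y n.
    (* In the constant, [|z|] comes from the odd power of [z], and [Num.max M 0] from the extra
       Lebesgue integration in [trig_q_odd_le]. *)
    exists (`|z| * Num.max M 0), (z ^+ 2 * Num.max M 0).
    have M0 : 0 <= Num.max M 0 by rewrite le_max lexx orbT.
    split; first exact: mulr_ge0.
    move=> x xM n.
    rewrite /a/= !normrM normrX normrN1 expr1n mul1r exprD expr1 exprM normrM.
    rewrite (ger0_norm (exprn_ge0 _ z20)) mulrAC [leLHS]mulrC -mulrA.
    rewrite ler_wpM2l// (ger0_norm ((ge0_nd_trig_q _ _).1 _)) addn1.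
    apply: le_trans (_ : z ^+ 2 ^+ n * (posXn_fact n x * Num.max M 0) <= _).
      apply: ler_wpM2l; first exact: exprn_ge0.
      apply: le_trans (trig_q_odd_le _ _ _) _.
      rewrite ler_wpM2l ?(ge0_nd_posXn_fact _).1//.
      by rewrite ge_max !le_max xM lexx orbT.
    by rewrite mulrA [leRHS]mulrC ler_wpM2r//; exact: exprM_posXn_fact.
  have := is_sum_sqr_Lnorm2_series mu01 ma a_le.
  rewrite [X in is_sum X](_ : _ = (fun n : nat => (-1) ^+ n * z ^+ (2 * n + 2) *
       \sum_(0 <= k < n.+2)
         ((n%:R + 1 - 2 * k%:R) * trig_q1 mu (2 * k + 1) *
          trig_q1 mu (2 * n + 2 - 2 * k))))//.
  apply/funext => n; transitivity ((-1) ^+ n * z ^+ (2 * n + 2) *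
      \sum_(0 <= k < n.+1) \int[mu]_(x in `[0, 1])
        (trig_q mu (2 * k).+1 \* trig_q mu (2 * (n - k)).+1) x).
    rewrite mulr_sumr; apply: eq_big_nat => k /andP[_]; rewrite ltnS => kn.
    rewrite Rintegral_scaled_product; try exact: ge0_nd_trig_q.
    rewrite mulrACA -!exprD !addn1 subnKC//.
    by have -> : ((2 * k).+1 + (2 * (n - k)).+1 = 2 * n + 2)%N by lia.
  rewrite -sum_trig_q; congr (_ * _); apply: eq_big_nat => k /andP[_].
  rewrite ltnS => kn; rewrite mulrA addn1.
  by have -> : (2 * n + 2 - 2 * k = 2 * (n.+1 - k))%N by lia.
Qed.
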